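(* Let $k$ be an algebraically closed field of characteristic zero and let $\Delta,\Delta'$ be trinomial data over $k$ in Mori form. If $k[\Delta]\cong k[\Delta']$ as $k$-algebras, then $\Delta=\Delta'$.
   Context: Trinomial data with unit partition over $k$ consist of an integer $r\ge 1$, pairwise relatively prime positive integers $\beta_0,\dots,\beta_r$, and distinct elements $\lambda_2,\dots,\lambda_r\in k^*$ (the empty sequence if $r=1$). For such data $\Delta$, $$k[\Delta]=k[T_0,\dots,T_r]/(T_0^{\beta_0}+\lambda_iT_1^{\beta_1}+T_i^{\beta_i})_{2\le i\le r},$$ where $T_0,\dots,T_r$ are independent variables (so $k[\Delta]=k[T_0,T_1]$ if $r=1$). $\Delta$ is in Mori form if it is trinomial data with unit partition and either (1) $r=1$ and $\beta_0=\beta_1=1$, or (2) $r\ge 2$, $\lambda_2=1$ and $\beta_0>\beta_1>\cdots>\beta_r\ge 2$. Equality $\Delta=\Delta'$ means that the integers $r$, the sequences $(\beta_i)$ and the sequences $(\lambda_i)$ coincide. *)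

(* Defs.v *)
From HB Require Import structures.
From mathcomp Require Import all_boot all_order all_algebra.
From mathcomp Require Import ring_quotient mpoly boolp.

Set Implicit Arguments.
Unset Strict Implicit.
Unset Printing Implicit Defensive.

Import GRing.Theory.
Local Open Scope ring_scope.
Local Open Scope quotient_scope.

(* [ring_quotient] only provides the ring structure on the quotient of a
   commutative ring by a proper ideal; the next section adds the scalar action
   given by [a *: \pi p = \pi (a *: p)] when the ring is a commutative algebra. *)
Section AlgebraQuotient.
Variables (K : comNzRingType) (A : comAlgType K) (I : idealr A).
Local Notation Q := {ideal_quot I}.

Definition quot_scale (a : K) : Q -> Q := lift_op1 Q ( *:%R a).

Lemma pi_scale a : {morph \pi_Q : p / a *: p >-> quot_scale a p}.
Proof.
move=> p; unlock quot_scale.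
rewrite -[a *: repr _]mulr_algl -[a *: p]mulr_algl !rmorphM.
by congr (_ * _); apply/esym/reprK.
Qed.
Canonical pi_scale_morph a := PiMorph1 (pi_scale a).

Lemma quot_scaleA a b x :
  quot_scale a (quot_scale b x) = quot_scale (a * b) x.
Proof. by rewrite -[x]reprK !piE scalerA. Qed.

Lemma quot_scale1 : left_id 1 quot_scale.
Proof. by move=> x; rewrite -[x]reprK !piE scale1r. Qed.

Lemma quot_scaleDr : right_distributive quot_scale +%R.
Proof. by move=> a x y; rewrite -[x]reprK -[y]reprK !piE scalerDr. Qed.

Lemma quot_scaleDl x : {morph quot_scale^~ x : a b / a + b}.
Proof. by move=> a b; rewrite -[x]reprK !piE scalerDl. Qed.

HB.instance Definition _ := GRing.Zmodule_isLmodule.Build K Q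
  quot_scaleA quot_scale1 quot_scaleDr quot_scaleDl.

Lemma quot_scaleAl (a : K) (x y : Q) : a *: (x * y) = a *: x * y.
Proof.
change (quot_scale a (x * y) = quot_scale a x * y).
by rewrite -[x]reprK -[y]reprK !piE scalerAl.
Qed.

HB.instance Definition _ := GRing.Lmodule_isLalgebra.Build K Q quot_scaleAl.
HB.instance Definition _ := GRing.Lalgebra_isComAlgebra.Build K Q.

End AlgebraQuotient.

(* [exponents] is beta_0, ..., beta_r and [coeffs] is lambda_2, ..., lambda_r,
   so that lambda_i is the entry of index i - 2.  The conditions are booleans:
   equality of two data amounts to equality of r and of the two sequences. *)
Record trinomial_data (k : fieldType) := TrinomialData {
  rank : nat;
  exponents : (rank.+1).-tuple nat;
  coeffs : (rank.-1).-tuple k;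
  rank_ge1 : (1 <= rank)%N;
  exponents_gt0 : all (leq 1) exponents;
  exponents_coprime : pairwise coprime exponents;
  coeffs_neq0 : 0 \notin coeffs;
  coeffs_uniq : uniq coeffs
}.

Section TrinomialAlgebra.
Variables (k : fieldType) (D : trinomial_data k).
Local Notation r := (rank D).

Definition expo (i : nat) : nat := nth 0%N (exponents D) i.

Definition coef (i : nat) : k := nth 0 (coeffs D) (i - 2).

(* Only used for i <= r: [inord i] is then the index i itself. *)
Definition Tvar (i : nat) : {mpoly k[r.+1]} := 'X_(inord i).

Definition trinomial (i : nat) : {mpoly k[r.+1]} :=
  Tvar 0 ^+ expo 0 + coef i *: Tvar 1 ^+ expo 1 + Tvar i ^+ expo i.

Definition trinomial_ideal (p : {mpoly k[r.+1]}) : bool :=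
  `[< exists c : nat -> {mpoly k[r.+1]},
        p = \sum_(2 <= i < r.+1) c i * trinomial i >].

Lemma trinomial_at0 i : (i <= r)%N -> (trinomial i).@[fun=> 0] = 0.
Proof.
move=> ler.
have expo_gt0 j : (j <= r)%N -> (0 < expo j)%N.
  move=> ljr; apply: (allP (exponents_gt0 D)).
  by rewrite mem_nth // size_tuple.
have Tvar_at0 j : (j <= r)%N -> (Tvar j ^+ expo j).@[fun=> 0] = 0.
  move=> ljr; rewrite rmorphXn /= mevalXU expr0n.
  by case: (expo j) (expo_gt0 j ljr).
by rewrite /trinomial !mevalD mevalZ !Tvar_at0 ?mulr0 ?addr0 // rank_ge1.
Qed.

Lemma trinomial_ideal_closed : idealr_closed trinomial_ideal.
Proof.
split.
- apply/asboolP; exists (fun=> 0).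
  by rewrite big1 // => i _; rewrite mul0r.
- apply/asboolP => -[c /(congr1 (meval (fun=> 0)))].
  rewrite rmorph1 raddf_sum /= big_nat big1 => [/eqP|i /andP[_ ltir]].
    by rewrite oner_eq0.
  by rewrite mevalM trinomial_at0 ?mulr0.
- move=> a _ _ /asboolP[c ->] /asboolP[d ->]; apply/asboolP.
  exists (fun i => a * c i + d i).
  rewrite mulr_sumr -big_split /=.
  by apply: eq_bigr => i _; rewrite mulrDl mulrA.
Qed.

HB.instance Definition _ :=
  isIdealr.Build {mpoly k[r.+1]} trinomial_ideal trinomial_ideal_closed.

Definition trinomial_algebra : comAlgType k :=
  {ideal_quot (trinomial_ideal : idealr {mpoly k[r.+1]})}.

Definition mori_form : Prop :=
     [/\ r = 1%N, expo 0 = 1%N & expo 1 = 1%N]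
  \/ [/\ (2 <= r)%N, coef 2 = 1,
         (forall i, (i < r)%N -> (expo i.+1 < expo i)%N) & (2 <= expo r)%N].

End TrinomialAlgebra.

(* Main.v *)
(* Give [k[D]], for a rank at least 2, the grading in which [T_i] has degree
   [w_i], the product of the [beta_j] with [j != i], so that the relations are
   homogeneous of degree [L], the product of all [beta_j].  By the Chinese
   remainder theorem a monomial of degree less than [L] is determined by its
   degree.  Deriving the relations and comparing components, it follows that a
   derivation has no component of negative degree, and that its component of
   degree 0 is a constant multiple of the Euler derivation.

   Apply this to the Euler derivation of [k[D]] transported by an isomorphism [f]
   to [k[D']].  If [b] is homogeneous of degree [n], then [f b] is an eigenvector
   for the eigenvalue [n], so that its lowest component has degree [e] with
   [n = C e], where [C] does not depend on [b].  The semigroups of degrees of the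
   two algebras are therefore proportional, and so are their minimal generators
   [w_i] and [w'_i]; this gives [r = r'], and coprimality gives [beta = beta'].
   The lowest component of [f T_i] is then a multiple of [T'_i], and the
   components of degree [L] of the relations determine the coefficients.

   If instead [k[D]] is a polynomial ring in two variables, use its grading of
   weights (1, 0): the image of [T_1 - c] for a suitable constant [c] has a lowest
   component of positive degree, although the eigenvalue is 0. *)
From HB Require Import structures.
Require Import Defs.
From mathcomp Require Import all_boot all_order all_algebra.
From mathcomp Require Import ring_quotient mpoly boolp ring zify.

Set Implicit Arguments.
Unset Strict Implicit.
Unset Printing Implicit Defensive.

Import GRing.Theory.
Local Open Scope ring_scope.

(** * The algebra as a quotient of a polynomial ring *)

Section Presentation.
Variables (k : fieldType) (D : trinomial_data k).
Local Notation r := (rank D).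
Local Notation P := {mpoly k[r.+1]}.
Local Notation B := (trinomial_algebra D).

Definition tproj (p : P) : B :=
  (\pi_({ideal_quot (@trinomial_ideal k D : idealr P)}) p)%qT.

Lemma tproj_is_additive : additive tproj.
Proof. by move=> p q; rewrite /tproj rmorphB. Qed.

Lemma tproj_is_monoid_morphism : monoid_morphism tproj.
Proof. by split=> [|p q]; rewrite /tproj ?rmorph1 ?rmorphM. Qed.

Lemma tproj_is_scalable : scalable tproj.
Proof. by move=> a p; rewrite /tproj; exact: pi_scale. Qed.

HB.instance Definition _ := GRing.isAdditive.Build P B tproj tproj_is_additive.
HB.instance Definition _ :=
  GRing.isMonoidMorphism.Build P B tproj tproj_is_monoid_morphism.
HB.instance Definition _ :=
  GRing.isScalable.Build k P B *:%R tproj tproj_is_scalable.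

Lemma tproj_surj (b : B) : exists p, b = tproj p.
Proof. by exists (repr b); rewrite /tproj reprK. Qed.

Lemma tproj_eq p q : tproj p = tproj q <-> trinomial_ideal (p - q).
Proof.
rewrite /tproj; split=> [/eqP|h]; first by rewrite -Quotient.idealrBE.
by apply/eqP; rewrite -Quotient.idealrBE.
Qed.

Definition gen (i : nat) : B := tproj (Tvar D i).

Lemma gen_trinomial i : (2 <= i <= r)%N ->
  gen 0 ^+ expo D 0 + coef D i *: gen 1 ^+ expo D 1 + gen i ^+ expo D i = 0.
Proof.
move=> /andP[i2 ir]; rewrite /gen -!rmorphXn -linearZ -!rmorphD /=.
rewrite -(rmorph0 tproj); apply/tproj_eq; rewrite subr0.
apply/asboolP; exists (fun j => (j == i)%:R).
rewrite (bigD1_seq i) ?mem_index_iota ?iota_uniq ?i2 //= eqxx mul1r.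
by rewrite big1 ?addr0 // => j /negPf ->; rewrite mul0r.
Qed.

(** Universal property of the presentation. Scalars act on [S] through [h], so that the same lemma
    yields coactions with values in [{poly B}] and points with values in [k]. *)
Lemma tproj_lift (S : comNzRingType) (h : {rmorphism k -> S}) (t : nat -> S) :
  (forall i, (2 <= i <= r)%N ->
    t 0%N ^+ expo D 0 + h (coef D i) * t 1%N ^+ expo D 1 + t i ^+ expo D i = 0) ->
  exists g : {rmorphism B -> S},
    (forall i, (i <= r)%N -> g (gen i) = t i) /\
    (forall c b, g (c *: b) = h c * g b).
Proof.
move=> ht; pose phi : P -> S := mmap h (fun i : 'I_r.+1 => t i).
pose ev (b : B) : S := phi (repr b).
have phi_var i : (i <= r)%N -> phi (Tvar D i) = t i.
  by move=> ir; rewrite /phi /Tvar mmapX mmap1U inordK.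
have phi_ideal p : trinomial_ideal p -> phi p = 0.
  move=> /asboolP[c ->]; rewrite /phi raddf_sum /= big_nat big1 // => i /andP[i2 ir].
  rewrite rmorphM /= /trinomial !rmorphD /= !rmorphXn mmapZ rmorphXn /= -/phi.
  by rewrite !phi_var // ?ht ?mulr0 ?i2 ?rank_ge1.
have evE p : ev (tproj p) = phi p.
  apply/eqP; rewrite -subr_eq0 /ev /phi -rmorphB /=; apply/eqP/phi_ideal.
  by apply/tproj_eq; rewrite /tproj reprK.
have ev_add : additive ev.
  move=> x y; have [p ->] := tproj_surj x; have [q ->] := tproj_surj y.
  by rewrite -rmorphB !evE /phi rmorphB.
have ev_mul : monoid_morphism ev.
  split=> [|x y]; first by rewrite -(rmorph1 tproj) evE /phi rmorph1.
  have [p ->] := tproj_surj x; have [q ->] := tproj_surj y.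
  by rewrite -rmorphM !evE /phi rmorphM.
pose eva := GRing.isAdditive.Build B S ev ev_add.
pose evm := GRing.isMonoidMorphism.Build B S ev ev_mul.
pose g : {rmorphism B -> S} := HB.pack ev eva evm.
exists g; split=> [i ir|c b] /=; first by rewrite evE phi_var.
have [p ->] := tproj_surj b.
by rewrite -linearZ /= !evE /phi mmapZ.
Qed.

End Presentation.

(** * Gradings, homogeneous components and Euler derivations *)

Section Grading.
Variables (k : fieldType) (D : trinomial_data k).
Local Notation r := (rank D).
Local Notation P := {mpoly k[r.+1]}.
Local Notation B := (trinomial_algebra D).
Implicit Types (w : nat -> nat) (m : 'X_{1..r.+1}) (b : B).

Definition mwt w m : nat := (\sum_(i < r.+1) m i * w i)%N.

Definition mon m : B := tproj 'X_[m].

Lemma mwtD w m1 m2 : mwt w (m1 + m2) = (mwt w m1 + mwt w m2)%N.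
Proof.
by rewrite /mwt -big_split; apply: eq_bigr => i _; rewrite mnmDE mulnDl.
Qed.

Lemma mwtU w (i : 'I_r.+1) : mwt w U_(i) = w i.
Proof.
rewrite /mwt (bigD1 i) //= mnm1E eqxx mul1n big1 ?addn0 // => j ji.
by rewrite mnm1E eq_sym (negPf ji).
Qed.

Lemma mwt0 w : mwt w 0%MM = 0%N.
Proof. by rewrite /mwt big1 // => i _; rewrite mnm0E. Qed.

Lemma mwtMn w m n : mwt w (m *+ n)%MM = (n * mwt w m)%N.
Proof. by elim: n => [|n IH]; rewrite ?mulm0n ?mwt0 // mulmS mwtD IH mulSn. Qed.

Lemma mwt_sum w (I : finType) (F : I -> 'X_{1..r.+1}) :
  mwt w (\sum_i F i)%MM = (\sum_i mwt w (F i))%N.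
Proof. by apply: big_morph; [exact: mwtD | exact: mwt0]. Qed.

Lemma mon0 : mon 0%MM = 1.
Proof. by rewrite /mon mpolyX0 rmorph1. Qed.

Lemma monD m1 m2 : mon (m1 + m2) = mon m1 * mon m2.
Proof. by rewrite /mon mpolyXD rmorphM. Qed.

Lemma monU (i : 'I_r.+1) : mon U_(i) = gen D i.
Proof. by rewrite /mon /gen /Tvar inord_val. Qed.

Lemma monMn m n : mon (m *+ n)%MM = mon m ^+ n.
Proof. by elim: n => [|n IH]; rewrite ?mulm0n ?mon0 // mulmS monD IH exprS. Qed.

Lemma monE m : mon m = \prod_(i < r.+1) gen D i ^+ m i.
Proof.
rewrite /mon mpolyXE_id rmorph_prod; apply: eq_bigr => i _.
by rewrite rmorphXn -monU.
Qed.

Lemma tproj_mon (p : P) : tproj p = \sum_(m <- msupp p) p@_m *: mon m.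
Proof.
by rewrite {1}[p]mpolyE raddf_sum; apply: eq_bigr => m _; exact: linearZ.
Qed.

(* [rho] is the coaction of the multiplicative group defining a grading of the
   algebra: the component of degree [n] of [b] is the coefficient [(rho b)`_n]. *)
Definition is_grading w (rho : {rmorphism B -> {poly B}}) : Prop :=
  (forall i, (i <= r)%N -> rho (gen D i) = (gen D i)%:P * 'X^(w i)) /\
  (forall c b, rho (c *: b) = (c%:A)%:P * rho b).

(** Sending [T_i] to [T_i 'X^(w i)] multiplies each relation by ['X^L]. In rank 1 there are no
    relations, so all weights are allowed. *)
Lemma grading_exists w L :
  (forall i, (2 <= i <= r)%N ->
     [/\ w 0%N * expo D 0 = L, w 1%N * expo D 1 = L & w i * expo D i = L]%N) ->
  exists rho, is_grading w rho.
Proof.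
move=> hw; pose h : {rmorphism k -> {poly B}} := polyC \o in_alg B.
have [i|rho [rho_gen rho_scale]] :=
    @tproj_lift k D _ h (fun i => (gen D i)%:P * 'X^(w i)).
  move=> ir; have [h0 h1 hi] := hw i ir.
  rewrite !exprMn -!exprM h0 h1 hi /= mulrA -!mulrDl -!polyC_exp.
  by rewrite -polyCM mulr_algl -!polyCD gen_trinomial // polyC0 mul0r.
by exists rho.
Qed.

Variables (w : nat -> nat) (rho : {rmorphism B -> {poly B}}).
Hypothesis rhoP : is_grading w rho.

Lemma grading_mon m : rho (mon m) = (mon m)%:P * 'X^(mwt w m).
Proof.
rewrite monE rmorph_prod rmorph_prod /=.
transitivity (\prod_(i < r.+1) ((gen D i ^+ m i)%:P * 'X^(m i * w i)) : {poly B}).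
  apply: eq_bigr => i _; rewrite rmorphXn /= (rhoP.1) -1?ltnS //.
  by rewrite exprMn -exprM mulnC polyC_exp.
by rewrite big_split /= -expr_sum.
Qed.

Lemma grading_tproj (p : P) :
  rho (tproj p) = \sum_(m <- msupp p) (p@_m *: mon m)%:P * 'X^(mwt w m).
Proof.
rewrite tproj_mon raddf_sum; apply: eq_bigr => m _ /=.
by rewrite rhoP.2 grading_mon mulrA -polyCM mulr_algl.
Qed.

Lemma comp_tproj n (p : P) :
  (rho (tproj p))`_n = \sum_(m <- msupp p | mwt w m == n) p@_m *: mon m.
Proof.
rewrite grading_tproj coef_sum [RHS]big_mkcond; apply: eq_bigr => m _.
by rewrite coefCM coefXn eq_sym; case: ifP => _; rewrite ?mulr1 ?mulr0.
Qed.

Lemma grading_eval1 b : (rho b).[1] = b.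
Proof.
have [p ->] := tproj_surj b; rewrite grading_tproj tproj_mon.
rewrite horner_sum; apply: eq_bigr => m _.
by rewrite hornerCM hornerXn expr1n mulr1.
Qed.

(** Coassociativity of the coaction: every component is itself homogeneous. *)
Lemma grading_comp b n : rho (rho b)`_n = ((rho b)`_n)%:P * 'X^n.
Proof.
have [p ->] := tproj_surj b; rewrite comp_tproj.
rewrite !raddf_sum mulr_suml /=; apply: eq_bigr => m /eqP <-.
by rewrite rhoP.2 grading_mon mulrA -polyCM mulr_algl.
Qed.

Lemma comp_sum b : b = \sum_(n < size (rho b)) (rho b)`_n.
Proof.
rewrite -{1}[b]grading_eval1 horner_coef; apply: eq_bigr => n _.
by rewrite expr1n mulr1.
Qed.

Lemma comp_exists_mon b n : (rho b)`_n != 0 -> exists m, mwt w m = n.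
Proof.
have [p ->] := tproj_surj b; rewrite comp_tproj => nz.
case: (boolP (has (fun m => mwt w m == n) (msupp p))) => [/hasP[m _ /eqP]|].
  by exists m.
move=> /hasPn no; case/eqP: nz; rewrite big_seq_cond big1 // => m /andP[mp].
by rewrite (negPf (no m mp)).
Qed.

(** Combined with [mwt_inj], this makes the components of degree below [degL] multiples of a single
    monomial. *)
Lemma comp_mon_unique b m n : mwt w m = n ->
  (forall m', mwt w m' = n -> m' = m) -> exists xi, (rho b)`_n = xi *: mon m.
Proof.
move=> mn mu; have [p ->] := tproj_surj b; rewrite comp_tproj.
exists (\sum_(m' <- msupp p | mwt w m' == n) p@_m').
by rewrite scaler_suml; apply: eq_bigr => m' /eqP/mu ->.
Qed.

(** Differentiating the coaction at 1 multiplies the component of degree [n] by [n]. *)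
Definition euler b : B := ((rho b)^`()).[1].

Lemma euler_is_additive : additive euler.
Proof. by move=> x y; rewrite /euler rmorphB derivB hornerD hornerN. Qed.

Lemma eulerM x y : euler (x * y) = euler x * y + x * euler y.
Proof. by rewrite /euler rmorphM derivM hornerD !hornerM !grading_eval1. Qed.

Lemma eulerZ c b : euler (c *: b) = c *: euler b.
Proof.
by rewrite /euler rhoP.2 deriv_mulC hornerCM mulr_algl.
Qed.

Lemma euler_hom b n : rho b = b%:P * 'X^n -> euler b = n%:R *: b.
Proof.
move=> h; rewrite /euler h deriv_mulC hornerCM derivXn hornerMn hornerXn expr1n.
by rewrite scaler_nat mulr_natr.
Qed.

End Grading.

(** * Natural numbers in a field of characteristic zero *)

Lemma natr_neq0 (k : fieldType) n : [pchar k] =i pred0 ->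
  (0 < n)%N -> n%:R != 0 :> k.
Proof. by move=> char0 n0; rewrite (pcharf0P k).1 // -lt0n. Qed.

Lemma natr_inj (k : fieldType) : [pchar k] =i pred0 ->
  injective (fun n : nat => n%:R : k).
Proof.
move=> char0.
have lt_neq m n : (m < n)%N -> m%:R <> n%:R :> k.
  move=> mn /esym/eqP; rewrite -subr_eq0 -natrB; last exact: ltnW.
  by rewrite (negPf (natr_neq0 char0 _)) // subn_gt0.
by move=> m n; case: (ltngtP m n) => // h e; case: (lt_neq _ _ h).
Qed.

(** The field has no order, so [C] is eliminated: [n * e' = n' * e] holds in [k], hence in the
    natural numbers, where sizes can be compared. *)
Lemma proportional_lt (k : fieldType) (C : k) n e n' e' :
  [pchar k] =i pred0 -> C != 0 ->
  n%:R = C * e%:R -> n'%:R = C * e'%:R -> (n < n')%N -> (e < e')%N.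
Proof.
move=> char0 C0 h h' nn'; have : (n * e' = n' * e)%N.
  by apply: (natr_inj char0); rewrite !natrM h h'; ring.
have : (0 < e')%N.
  case: e' h' => // /eqP; rewrite mulr0 (negPf (natr_neq0 char0 _)) //.
  exact: leq_ltn_trans nn'.
nia.
Qed.

(** * Arithmetic of the standard weights *)

Section StandardWeights.
Variables (k : fieldType) (D : trinomial_data k).
Local Notation r := (rank D).
Implicit Type m : 'X_{1..r.+1}.

Definition degL : nat := (\prod_(j < r.+1) expo D j)%N.

Definition stdw (i : nat) : nat := (\prod_(j < r.+1 | j != i :> nat) expo D j)%N.

Lemma expo_gt0 i : (i <= r)%N -> (0 < expo D i)%N.
Proof.
move=> ir; apply: (allP (exponents_gt0 D)).
by rewrite mem_nth // size_tuple.
Qed.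

Lemma expo_coprime i j : (i <= r)%N -> (j <= r)%N -> i != j ->
  coprime (expo D i) (expo D j).
Proof.
have lt_co a b : (a <= r)%N -> (b <= r)%N -> (a < b)%N ->
    coprime (expo D a) (expo D b).
  move=> ar br ab; have /(pairwiseP 0%N) := exponents_coprime D.
  by apply; rewrite // inE size_tuple ltnS.
move=> ir jr; rewrite neq_ltn => /orP[] h; first exact: lt_co.
by rewrite coprime_sym; apply: lt_co.
Qed.

Lemma stdw_expo i : (i <= r)%N -> (stdw i * expo D i)%N = degL.
Proof.
move=> ir; rewrite -ltnS in ir; rewrite /degL (bigD1 (Ordinal ir)) //= mulnC.
by congr (_ * _)%N; apply: eq_bigl => j; rewrite -val_eqE.
Qed.

Lemma degL_gt0 : (0 < degL)%N.
Proof. by apply: prodn_gt0 => j; apply: expo_gt0; rewrite -ltnS. Qed.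

Lemma stdw_gt0 i : (i <= r)%N -> (0 < stdw i)%N.
Proof. by move=> ir; have := degL_gt0; rewrite -(stdw_expo ir) muln_gt0 => /andP[]. Qed.

Lemma coprime_stdw i : (i <= r)%N -> coprime (expo D i) (stdw i).
Proof.
move=> ir; apply: (big_ind (fun n => coprime (expo D i) n)).
- exact: coprimen1.
- by move=> x y hx hy; rewrite coprimeMr hx hy.
- by move=> j ji; apply: expo_coprime; rewrite 1?eq_sym // -ltnS.
Qed.

Lemma stdw2_le i : (i <= r)%N -> (2 <= expo D i)%N -> (2 * stdw i <= degL)%N.
Proof. by move=> ir b2; rewrite -(stdw_expo ir) mulnC leq_mul2l b2 orbT. Qed.

Lemma stdw_ltL i : (i <= r)%N -> (2 <= expo D i)%N -> (stdw i < degL)%N.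
Proof. by move=> ir b2; have := stdw2_le ir b2; have := stdw_gt0 ir; lia. Qed.

Lemma stdw_lt i j : (i <= r)%N -> (j <= r)%N ->
  (expo D j < expo D i)%N -> (stdw i < stdw j)%N.
Proof.
move=> ir jr ji; have := stdw_expo ir; rewrite -(stdw_expo jr).
by have := stdw_gt0 ir; nia.
Qed.

Lemma dvdn_stdw i j : (i <= r)%N -> i != j -> (expo D i %| stdw j)%N.
Proof.
move=> ir ij; rewrite -ltnS in ir.
by rewrite /stdw (bigD1 (Ordinal ir)) //= dvdn_mulr.
Qed.

Lemma mwt_ge m (j : 'I_r.+1) : (m j * stdw j <= mwt stdw m)%N.
Proof. by rewrite /mwt (bigD1 j) //= leq_addr. Qed.

Lemma mwt_ge2 m (i j : 'I_r.+1) : i != j ->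
  (m i * stdw i + m j * stdw j <= mwt stdw m)%N.
Proof.
move=> ij; rewrite /mwt (bigD1 i) //= (bigD1 j) /=; last by rewrite eq_sym.
by rewrite addnA leq_addr.
Qed.

(** The weights of all other variables are multiples of [expo D j]. *)
Lemma mwt_mod m (j : 'I_r.+1) : mwt stdw m = m j * stdw j %[mod expo D j].
Proof.
rewrite /mwt (bigD1 j) //=; apply/eqP; rewrite -{2}[(m j * _)%N]addn0 eqn_modDl.
rewrite mod0n; apply: dvdn_sum => i ij; apply: dvdn_mull.
by apply: dvdn_stdw; rewrite 1?eq_sym // -ltnS.
Qed.

(* Chinese remainders: below degree [degL] every exponent is determined by its
   residue modulo the corresponding [expo]. *)
Lemma mwt_inj m m' : mwt stdw m = mwt stdw m' -> (mwt stdw m < degL)%N -> m = m'.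
Proof.
move=> e lt; apply/mnmP => j.
have jr : (j <= r)%N by rewrite -ltnS.
have bnd m1 : (mwt stdw m1 < degL)%N -> (m1 j < expo D j)%N.
  move=> lt1; have := leq_ltn_trans (mwt_ge m1 j) lt1.
  by rewrite -(stdw_expo jr) mulnC ltn_pmul2l // stdw_gt0.
have /eqP := mwt_mod m j; rewrite e (mwt_mod m' j).
have b := bnd _ lt; rewrite e in lt; have b' := bnd _ lt.
have inj a c : (a <= c)%N -> (c < expo D j)%N ->
    a * stdw j == c * stdw j %[mod expo D j] -> a = c.
  move=> ac cj; rewrite eq_sym eqn_mod_dvd ?leq_mul2r ?ac ?orbT //.
  rewrite -mulnBl Gauss_dvdl ?coprime_stdw // => dv; apply/eqP.
  rewrite eqn_leq ac -subn_eq0; apply/negPn/negP; rewrite -lt0n => gt.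
  by have := dvdn_leq gt dv; rewrite leqNgt (leq_ltn_trans (leq_subr _ _)).
move=> h; case: (leqP (m j) (m' j)) => [le|/ltnW le].
  by apply: inj; rewrite // eq_sym.
by apply/esym/inj.
Qed.

Lemma coef_neq0 i : (2 <= i <= r)%N -> coef D i != 0.
Proof.
move=> /andP[i2 ir]; apply: contraNneq (coeffs_neq0 D) => <-.
by rewrite mem_nth // size_tuple; lia.
Qed.

Lemma std_grading_exists : exists rho, @is_grading k D stdw rho.
Proof.
apply: (@grading_exists _ _ _ degL) => i /andP[i2 ir].
by rewrite !stdw_expo // (leq_trans _ ir) // ltnW.
Qed.

End StandardWeights.

(** * Points, nonvanishing of monomials and linear independence *)

Section Points.
Variables (k : closedFieldType) (D : trinomial_data k).
Local Notation r := (rank D).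
Local Notation B := (trinomial_algebra D).

Lemma nth_root_exists n (x : k) : (0 < n)%N -> exists y, y ^+ n = x.
Proof.
move=> n0; have [y hy] := @solve_monicpoly k n (fun i => if i == 0%N then x else 0) n0.
exists y; rewrite hy; case: n n0 {hy} => // n _.
by rewrite big_ord_recl expr0 mulr1 big1 ?addr0 // => i _; rewrite mul0r.
Qed.

(** The relations express the powers with [i >= 2] through the first two, which are free;
    coordinates are then extracted as roots in the algebraically closed field. *)
Lemma point_exists (u v : k) : exists ev : {rmorphism B -> k},
  [/\ ev (gen D 0) ^+ expo D 0 = u, ev (gen D 1) ^+ expo D 1 = v,
      forall i, (2 <= i <= r)%N -> ev (gen D i) ^+ expo D i = - (u + coef D i * v)
    & forall c b, ev (c *: b) = c * ev b].
Proof.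
pose X i := if i == 0%N then u else if i == 1%N then v else - (u + coef D i * v).
have /choice[t ht] i : exists y : k, (i <= r)%N -> y ^+ expo D i = X i.
  case: (leqP i r) => ir; last by exists 0.
  by have [y hy] := nth_root_exists (X i) (expo_gt0 ir); exists y.
have r1 : (1 <= r)%N := rank_ge1 D.
have [i /andP[i2 ir]|ev [ev_gen ev_scale]] := @tproj_lift k D k idfun t.
  by rewrite !ht //; case: i i2 ir => [|[|i]] //= _ _; rewrite /X /= subrr.
exists ev; split=> [|||//]; rewrite ?ev_gen ?ht // => i /andP[i2 ir].
by rewrite ev_gen // ht //; case: i i2 ir => [|[|i]].
Qed.

(** It suffices to find a point at which no variable vanishes: take [v = 1] and [u] different from 0
    and from every [- coef D i]. *)
Lemma mon_neq0 (m : 'X_{1..r.+1}) : mon m != 0 :> B.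
Proof.
pose s := 0 :: [seq - c | c <- coeffs D].
(* The forbidden values are the roots of [q], so any [u] with [q.[u] = 1] avoids them; one exists
   because [q] is not constant. *)
pose q : {poly k} := \prod_(c <- s) ('X - c%:P).
have [u /rootP] : exists u, root (q - 1) u.
  apply/closed_rootP; rewrite size_polyDl ?size_prod_XsubC //.
  by rewrite size_polyN size_poly1.
rewrite hornerD hornerN hornerC => /eqP; rewrite subr_eq0 => /eqP qu.
have us : u \notin s.
  by rewrite -root_prod_XsubC rootE -/q qu oner_eq0.
have [ev [e0 e1 ei evZ]] := point_exists u 1.
apply: contraTneq (oner_neq0 k) => m0; rewrite negbK.
have : ev (mon m) = 0 by rewrite m0 rmorph0.
rewrite monE rmorph_prod => /eqP/prodf_eq0[i _]; rewrite rmorphXn expf_eq0.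
case/andP=> _ /eqP gi0; have ir : (i <= r)%N by rewrite -ltnS.
have := expo_gt0 ir; case E : (nat_of_ord i) ir gi0 => [|[|j]] ir gi0 ej.
- move: us; rewrite -e0 gi0 expr0n eqn0Ngt ej /= inE eqxx //.
- by rewrite -e1 gi0 expr0n eqn0Ngt ej.
- move/eqP: (ei j.+2 ir); rewrite gi0 expr0n eqn0Ngt ej mulr1 eq_sym oppr_eq0.
  rewrite addr_eq0 => /eqP uE; move: us; rewrite uE inE mem_map ?mem_nth ?orbT //.
    by rewrite size_tuple; lia.
  exact: oppr_inj.
Qed.

Lemma gen01_indep (a b : k) :
  a *: gen D 0 ^+ expo D 0 + b *: gen D 1 ^+ expo D 1 = 0 -> a = 0 /\ b = 0.
Proof.
move=> h; have at_pt u v : a * u + b * v = 0.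
  have [ev [e0 e1 _ evZ]] := point_exists u v.
  by have := congr1 ev h; rewrite rmorph0 rmorphD !evZ !rmorphXn e0 e1.
by have := at_pt 1 0; have := at_pt 0 1; rewrite !mulr1 !mulr0 add0r addr0.
Qed.

End Points.

(** * Lowest components of derivations *)

Lemma poly_low_coefs (R : comNzRingType) (p : {poly R}) n a :
  (forall i, (i < n)%N -> p`_i = 0) -> p`_n = a ->
  exists s, p = 'X^n * (a%:P + 'X * s).
Proof.
move=> p0 pn; exists (drop_poly n.+1 p).
rewrite -{1}(poly_take_drop n.+1 p) mulrDr mulrA -exprSr addrC.
rewrite [X in X + _]mulrC addrC; congr (_ + _); apply/polyP => i.
rewrite coef_take_poly mulrC coefCM coefXn ltnS.
by case: ltngtP => [/p0->|_|->]; rewrite ?mulr1 ?mulr0.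
Qed.

Section Derivation.
Variables (k : closedFieldType) (D : trinomial_data k).
Local Notation r := (rank D).
Local Notation B := (trinomial_algebra D).
Local Notation w := (stdw D).
Local Notation L := (degL D).
Local Notation t := (gen D).
Local Notation beta := (expo D).

Hypothesis char0 : [pchar k] =i pred0.
Hypothesis rank_ge2 : (2 <= r)%N.
Hypothesis beta_ge2 : forall i, (i <= r)%N -> (2 <= beta i)%N.

Variable rho : {rmorphism B -> {poly B}}.
Hypothesis rhoP : is_grading w rho.

Variable d : B -> B.
Hypothesis dB : additive d.
Hypothesis dM : forall x y, d (x * y) = d x * y + x * d y.
Hypothesis dZ : forall c x, d (c *: x) = c *: d x.

Lemma deriv0 : d 0 = 0.
Proof. by rewrite -(subrr 0) dB !subrr. Qed.

Lemma deriv_add x y : d (x + y) = d x + d y.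
Proof. by rewrite -{1}[y]opprK dB -[- y]sub0r dB deriv0 sub0r opprK. Qed.

Lemma deriv_sum (I : Type) (s : seq I) (P : pred I) F :
  d (\sum_(i <- s | P i) F i) = \sum_(i <- s | P i) d (F i).
Proof. by apply: big_morph; [exact: deriv_add | exact: deriv0]. Qed.

Lemma deriv1 : d 1 = 0.
Proof.
by have := dM 1 1; rewrite !mul1r mulr1 => /esym/(canRL (addrK _)); rewrite subrr.
Qed.

Lemma deriv_exp x n : d (x ^+ n) = n%:R *: (x ^+ n.-1 * d x).
Proof.
case: n => [|n]; first by rewrite expr0 deriv1 scale0r.
elim: n => [|n IH]; first by rewrite expr1 scale1r mul1r.
rewrite exprS dM IH /= -scalerAr [d x * _]mulrC [x * (_ * _)]mulrA -exprS.
by rewrite -[n.+2%:R]natr1 scalerDl scale1r addrC.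
Qed.

(* Deriving the relations yields a linear relation between the [K j n], for each
   degree [n]. *)
Let K j n : B := (rho (t j ^+ (beta j).-1 * d (t j)))`_n.

Lemma K_rel i n : (2 <= i <= r)%N ->
  (beta 0)%:R *: K 0 n + (coef D i * (beta 1)%:R) *: K 1 n
    + (beta i)%:R *: K i n = 0.
Proof.
move=> ir; have := congr1 (fun x => (rho (d x))`_n) (gen_trinomial ir).
rewrite deriv0 rmorph0 coef0 !deriv_add dZ !deriv_exp !rmorphD !(rhoP.2) !coefD !coefCM.
by rewrite !mulr_algl scalerA.
Qed.

(** The component of [d (t j)] involved has degree at most [n < L], so it is a multiple of one
    monomial, which is then multiplied by [t j ^+ (beta j).-1]. *)
Lemma K_mon (j : 'I_r.+1) n : (n < L)%N -> K j n != 0 ->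
  exists xi m, [/\ mwt w m = n, K j n = xi *: mon m & ((beta j).-1 <= m j)%N].
Proof.
move=> nL; have jr : (j <= r)%N by rewrite -ltnS.
rewrite /K rmorphM rmorphXn (rhoP.1) // exprMn -exprM -polyC_exp.
rewrite -mulrA coefCM coefXnM; case: ltnP => [_|le]; first by rewrite mulr0 eqxx.
case: (eqVneq (rho (d (t j)))`_(n - w j * (beta j).-1) 0) => [->|nz _].
  by rewrite mulr0 eqxx.
have [m mE] := comp_exists_mon rhoP nz.
have [m' m'E|xi ->] := comp_mon_unique rhoP (d (t j)) mE.
  apply: mwt_inj; rewrite ?mE ?m'E //.
  exact: leq_ltn_trans (leq_subr _ _) nL.
exists xi, (U_(j) *+ (beta j).-1 + m)%MM; split.
- by rewrite mwtD mwtMn mwtU mE mulnC subnKC.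
- by rewrite monD monMn monU -scalerAr.
- by rewrite mnmDE mulmnE mnm1E eqxx mul1n leq_addr.
Qed.

(** If both were nonzero, the unique monomial of degree [n] would contain both powers, and its
    weight would be at least [2 L - w i - w j]. This is at least [L], since exponents are at least
    2. *)
Lemma K_pair (i j : 'I_r.+1) n : (n < L)%N -> i != j ->
  K i n = 0 \/ K j n = 0.
Proof.
move=> nL ij.
case: (eqVneq (K i n) 0) => [|ni]; first by left.
case: (eqVneq (K j n) 0) => [|nj]; first by right.
have [_ [m [mE _ mi]]] := K_mon nL ni.
have [_ [m' [m'E _ mj]]] := K_mon nL nj.
have e : m' = m by apply: mwt_inj; rewrite ?mE ?m'E.
have := mwt_ge2 m ij; rewrite e in mj.
have ir : (i <= r)%N by rewrite -ltnS.
have jr : (j <= r)%N by rewrite -ltnS.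
have := stdw_expo ir; have := stdw_expo jr.
have := stdw2_le ir (beta_ge2 ir); have := stdw2_le jr (beta_ge2 jr).
have := leq_mul mi (leqnn (w i)); have := leq_mul mj (leqnn (w j)).
have := beta_ge2 ir; have := beta_ge2 jr; nia.
Qed.

(* Hence a derivation has no component of negative degree: below [degL] at most
   one term of each relation [K_rel] is nonzero, so none is. *)
Lemma K_eq0 j n : (j <= r)%N -> (n < L)%N -> K j n = 0.
Proof.
move=> jr nL.
have two a b (x y : B) : a != 0 -> b != 0 -> a *: x + b *: y = 0 ->
    x = 0 \/ y = 0 -> x = 0 /\ y = 0.
  move=> a0 b0 + [] e; rewrite e scaler0 ?add0r ?addr0 => /eqP;
  by rewrite scaler_eq0 (negPf a0, negPf b0) => /eqP.
have pair a b : (a <= r)%N -> (b <= r)%N -> a != b -> K a n = 0 \/ K b n = 0.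
  rewrite -!(ltnS _ r) => ar br ab.
  exact: (@K_pair (Ordinal ar) (Ordinal br)).
have all3 i : (2 <= i <= r)%N -> [/\ K 0 n = 0, K 1 n = 0 & K i n = 0].
  move=> i2r; have rel := K_rel n i2r; have ci := coef_neq0 i2r.
  case/andP: i2r => i2 ir; have r1 := rank_ge1 D.
  have b0 := natr_neq0 char0 (expo_gt0 (leq0n r : (0 <= r)%N)).
  have b1 := natr_neq0 char0 (expo_gt0 r1); have bi := natr_neq0 char0 (expo_gt0 ir).
  have c1 : coef D i * (beta 1)%:R != 0 by rewrite mulf_neq0.
  case: (pair 0%N 1%N) => // e; rewrite e scaler0 ?add0r ?addr0 in rel.
    have [|//] := two _ _ _ _ c1 bi rel; apply: pair => //; lia.
  have [|//] := two _ _ _ _ b0 bi rel; apply: pair => //; lia.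
have [|K0 K1 _] := all3 2%N; first by rewrite rank_ge2.
case: j jr => [|[|j]] // jr.
by have [] := all3 j.+2 jr.
Qed.

(** Multiplication by [t j ^+ (beta j).-1] moves degree [n] to a degree below [L], where [K_eq0]
    applies. The factor can be cancelled because the component is a multiple of one monomial and
    monomials are nonzero. *)
Lemma deriv_gen_low j n : (j <= r)%N -> (n < w j)%N -> (rho (d (t j)))`_n = 0.
Proof.
move=> jr nw; apply/eqP; case: eqP => // /eqP nz.
have [m mE] := comp_exists_mon rhoP nz.
have nL := ltn_trans nw (stdw_ltL jr (beta_ge2 jr)).
have [m' m'E|xi xiE] := comp_mon_unique rhoP (d (t j)) mE.
  by apply: mwt_inj; rewrite ?mE ?m'E.
have : K j (w j * (beta j).-1 + n) = 0.
  apply: K_eq0 => //; rewrite -(stdw_expo jr).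
  by have := beta_ge2 jr; case: (beta j) => // b _; rewrite mulnS; lia.
rewrite /K rmorphM rmorphXn (rhoP.1) // exprMn -exprM -polyC_exp.
rewrite -mulrA coefCM coefXnM ltnNge leq_addr /= addKn xiE -scalerAr.
rewrite -ltnS in jr; pose jo := Ordinal jr.
have -> : t j ^+ (beta j).-1 = mon (U_(jo) *+ (beta j).-1)%MM.
  by rewrite monMn monU.
move/eqP; rewrite -monD scaler_eq0 (negPf (mon_neq0 _)) orbF => /eqP x0.
by move: nz; rewrite xiE x0 scale0r eqxx.
Qed.

(** In degree [w j] the component is some [c j *: t j]. Comparing [K_rel] in degree [L] with the
    relation itself, and using [gen01_indep], shows that [c j * beta j] is independent of [j]; as
    [w j * beta j = L], [c j] is proportional to [w j]. *)
Lemma deriv_gen_diag : exists C, forall j, (j <= r)%N ->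
  (rho (d (t j)))`_(w j) = (C * (w j)%:R) *: t j.
Proof.
have /choice[c cE] j : exists c, (j <= r)%N -> (rho (d (t j)))`_(w j) = c *: t j.
  case: (leqP j r) => jr; last by exists 0.
  have jr' := jr; rewrite -ltnS in jr'; pose jo := Ordinal jr'.
  have [m' m'E|xi xiE] := @comp_mon_unique _ _ _ _ rhoP (d (t j)) U_(jo) (w j) (mwtU _ _).
    by apply: mwt_inj; rewrite ?mwtU ?m'E // stdw_ltL // beta_ge2.
  by exists xi => _; rewrite xiE monU.
have KL j : (j <= r)%N -> K j L = c j *: t j ^+ beta j.
  move=> jr; rewrite /K rmorphM rmorphXn (rhoP.1) // exprMn -exprM -polyC_exp.
  rewrite -mulrA coefCM coefXnM.
  have bj := expo_gt0 jr.
  have -> : L = (w j * (beta j).-1 + w j)%N.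
    by rewrite -(stdw_expo jr) -{1}(prednK bj) mulnS addnC.
  rewrite ltnNge leq_addr /= addKn cE // -scalerAr -exprSr prednK //.
have r1 := rank_ge1 D.
have eqC i : (2 <= i <= r)%N ->
    c 0%N * (beta 0)%:R = c i * (beta i)%:R /\ c 1%N * (beta 1)%:R = c i * (beta i)%:R.
  move=> i2r; have rel := K_rel L i2r; have ci := coef_neq0 i2r.
  have ti := gen_trinomial i2r; case/andP: i2r => i2 ir.
  move/(canRL (addKr _)): ti; rewrite addr0 => ti.
  move: rel; rewrite !KL // ti !scalerA scalerN scalerDr scalerA.
  set x := t 0 ^+ _; set y := t 1 ^+ _ => rel.
  have {rel} /gen01_indep[/eqP h0 /eqP h1] :
      ((beta 0)%:R * c 0%N - (beta i)%:R * c i) *: x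
      + (coef D i * (beta 1)%:R * c 1%N - (beta i)%:R * c i * coef D i) *: y = 0.
    by rewrite -{}rel !scalerBl opprD addrACA.
  split; first by apply/eqP; rewrite -subr_eq0 -(mulrC (beta 0)%:R) -(mulrC (beta i)%:R).
  apply: (mulfI ci); apply/eqP; rewrite -subr_eq0 -(eqP h1); apply/eqP; ring.
have CE j : (j <= r)%N -> c j * (beta j)%:R = c 0%N * (beta 0)%:R.
  have [|e0 e1] := eqC 2%N; first by rewrite rank_ge2.
  case: j => [|[|j]] // jr; first by rewrite e1 e0.
  by have [-> _] := eqC j.+2 jr.
have L0 := natr_neq0 char0 (degL_gt0 D).
exists (c 0%N * (beta 0)%:R / L%:R) => j jr; rewrite cE //; congr (_ *: _).
rewrite -(CE j jr); apply: (mulIf L0).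
rewrite mulrAC divfK // -(stdw_expo jr) natrM; ring.
Qed.

(** Induction on the monomial by the Leibniz rule. The factored form records both the absence of
    lower components and the value of the lowest one. *)
Lemma deriv_mon C m :
  (forall j, (j <= r)%N -> (rho (d (t j)))`_(w j) = (C * (w j)%:R) *: t j) ->
  exists s, rho (d (mon m)) =
    'X^(mwt w m) * (((C * (mwt w m)%:R) *: mon m)%:P + 'X * s).
Proof.
move=> hC.
pose Q m := exists s, rho (d (mon m)) =
    'X^(mwt w m) * (((C * (mwt w m)%:R) *: mon m)%:P + 'X * s).
have Q0 : Q 0%MM.
  by exists 0; rewrite mon0 mwt0 deriv1 rmorph0 !mulr0 scale0r addr0 mulr0.
have QU i : Q U_(i)%MM.
  rewrite /Q monU mwtU; have ir : (i <= r)%N by rewrite -ltnS.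
  by apply: poly_low_coefs; [move=> n; apply: deriv_gen_low | apply: hC].
have QD m1 m2 : Q m1 -> Q m2 -> Q (m1 + m2)%MM.
  case=> s1 h1 [s2 h2]; rewrite /Q monD mwtD dM rmorphD !rmorphM h1 h2.
  rewrite !(grading_mon rhoP); exists (s1 * (mon m2)%:P + (mon m1)%:P * s2).
  rewrite natrD [C * (_ + _)]mulrDr [(_ + _) *: _]scalerDl.
  rewrite -[_ *: mon m1]mulr_algl -[_ *: mon m2]mulr_algl.
  rewrite -![_ *: (_ * _)]mulr_algl.
  by rewrite !polyCD !polyCM exprD; ring.
suff : Q m by [].
clearbody Q; rewrite (multinomUE_id m).
apply: (big_ind Q Q0 QD) => i _.
elim: (m i) => [|n IH]; first by rewrite mulm0n.
by rewrite mulmS; apply: QD.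
Qed.

(** By [deriv_mon], [d] does not lower degrees, so only the component of [y] of degree [n]
    contributes to degree [n], and it does so diagonally. [C] is uniform in [y] and [n]. *)
Lemma deriv_lowest : exists C, forall (y : B) n,
  (forall l, (l < n)%N -> (rho y)`_l = 0) ->
  (rho (d y))`_n = (C * n%:R) *: (rho y)`_n.
Proof.
have [C hC] := deriv_gen_diag; exists C => y n ylow.
have hcomp l : (l >= n)%N -> (rho (d (rho y)`_l))`_n =
    if l == n then (C * n%:R) *: (rho y)`_n else 0.
  move=> nl; have [p ->] := tproj_surj y; rewrite !(comp_tproj rhoP).
  rewrite deriv_sum raddf_sum coef_sum /=.
  case: eqP => [ln|/eqP ln]; last first.
    apply: big1 => m /eqP ml; rewrite dZ (rhoP.2) coefCM.
    have [s ->] := deriv_mon m hC.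
    by rewrite coefXnM ml ltn_neqAle eq_sym ln nl mulr0.
  subst l; rewrite scaler_sumr; apply: eq_bigr => m /eqP ml.
  rewrite dZ (rhoP.2) coefCM; have [s ->] := deriv_mon m hC.
  rewrite coefXnM ml ltnn subnn coefD coefC coefXM eqxx addr0 mulr_algl.
  by rewrite !scalerA mulrC.
rewrite {1}(comp_sum rhoP y) deriv_sum raddf_sum coef_sum /=.
case: (ltnP n (size (rho y))) => [ns|sn]; last first.
  rewrite [X in _ = _ *: X]nth_default // scaler0 big1 // => l _.
  by rewrite ylow ?deriv0 ?rmorph0 ?coef0 // (leq_trans _ sn).
rewrite (bigD1 (Ordinal ns)) //= hcomp // eqxx big1 ?addr0 // => l ln.
case: (ltnP l n) => [/ylow->|nl]; first by rewrite deriv0 rmorph0 coef0.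
by rewrite hcomp //; case: eqP => // e; case/eqP: ln; apply: val_inj.
Qed.

End Derivation.

(** * Powers of polynomials and increasing sequences *)

Lemma lowest_coef_exp (R : comNzRingType) (p : {poly R}) n a e :
  (forall i, (i < n)%N -> p`_i = 0) -> p`_n = a -> (p ^+ e)`_(n * e) = a ^+ e.
Proof.
move=> low pn; have [s ->] := poly_low_coefs low pn.
rewrite exprMn -exprM coefXnM ltnn subnn -horner_coef0 horner_exp.
by rewrite hornerD hornerC hornerM hornerX mul0r addr0.
Qed.

Lemma increasing_ge (s : nat -> nat) r :
  (forall i, (i < r)%N -> (s i < s i.+1)%N) -> forall i, (i <= r)%N -> (i <= s i)%N.
Proof.
by move=> inc; elim=> // i IH ir; have := inc _ ir; have := IH (ltnW ir); lia.
Qed.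

(** From [i] the sequence still climbs at least [r - i] before reaching [s r <= r], so
    [s i <= i]. *)
Lemma increasing_id (s : nat -> nat) r :
  (s r <= r)%N -> (forall i, (i < r)%N -> (s i < s i.+1)%N) ->
  forall i, (i <= r)%N -> s i = i.
Proof.
move=> sr inc i ir; apply/eqP; rewrite eqn_leq (increasing_ge inc ir) andbT.
have [n rE] : exists n, r = (i + n)%N by exists (r - i)%N; lia.
suff : (s i + n <= r)%N by lia.
elim: n i ir rE => [|n IH] i ir rE; first by move: sr; rewrite rE !addn0.
by have := IH i.+1; have := inc i; lia.
Qed.

(** * Comparison of degrees through an isomorphism *)

Section Degrees.
Variables (k : closedFieldType) (D D' : trinomial_data k).
Local Notation B := (trinomial_algebra D).
Local Notation B' := (trinomial_algebra D').
Local Notation r := (rank D).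
Local Notation r' := (rank D').

Hypothesis char0 : [pchar k] =i pred0.
Hypothesis rank_ge2 : (2 <= r')%N.
Hypothesis expo_ge2 : forall i, (i <= r')%N -> (2 <= expo D' i)%N.

Variables (f : {lrmorphism B -> B'}) (g : B' -> B).
Hypotheses (fK : cancel f g) (gK : cancel g f).

Variables (w : nat -> nat) (rho : {rmorphism B -> {poly B}}).
Hypothesis rhoP : is_grading w rho.
Variable rho' : {rmorphism B' -> {poly B'}}.
Hypothesis rhoP' : is_grading (stdw D') rho'.

Lemma iso_neq0 b : b != 0 -> f b != 0.
Proof. by apply: contra_neq => fb; apply: (can_inj fK); rewrite fb rmorph0. Qed.

(** A relation rather than a function, since 0 has no order. *)
Definition has_order (y : B') n : Prop :=
  (forall l, (l < n)%N -> (rho' y)`_l = 0) /\ (rho' y)`_n != 0.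

Lemma order_exists y : y != 0 -> exists n, has_order y n.
Proof.
move=> y0; have ex : exists n, (rho' y)`_n != 0.
  apply: contrapT => no; case/eqP: y0; rewrite (comp_sum rhoP' y) big1 // => i _.
  by apply/eqP/negPn/negP => h; apply: no; exists i.
exists (ex_minn ex); case: ex_minnP => n yn mn; split=> // l ln.
by apply/eqP; apply: contraTT ln => h; rewrite -leqNgt mn.
Qed.

(** The transported Euler derivation [d] multiplies [f b] by [n] and its lowest component by
    [C * e]. The source weights [w] stay arbitrary, so that [not_plane] can use nonstandard ones. *)
Lemma order_proportional : exists C : k, forall b n e,
  rho b = b%:P * 'X^n -> has_order (f b) e -> n%:R = C * e%:R.
Proof.
pose d y := f (euler rho (g y)).
have gB x y : g (x - y) = g x - g y.
  by apply: (can_inj fK); rewrite gK rmorphB /= !gK.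
have gM x y : g (x * y) = g x * g y.
  by apply: (can_inj fK); rewrite gK rmorphM /= !gK.
have gZ c x : g (c *: x) = c *: g x.
  by apply: (can_inj fK); rewrite gK linearZ /= gK.
have dB : additive d by move=> x y; rewrite /d gB euler_is_additive rmorphB.
have dM x y : d (x * y) = d x * y + x * d y.
  by rewrite /d gM (eulerM rhoP) rmorphD !rmorphM /= !gK.
have dZ c x : d (c *: x) = c *: d x.
  by rewrite /d gZ (eulerZ rhoP) linearZ.
have [C hC] := deriv_lowest char0 rank_ge2 expo_ge2 rhoP' dB dM dZ.
exists C => b n e hb [low nz].
have := hC _ _ low; rewrite /d fK (euler_hom hb) linearZ /= rhoP'.2 coefCM mulr_algl.
by move/eqP; rewrite -subr_eq0 -scalerBl scaler_eq0 (negPf nz) orbF subr_eq0 => /eqP.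
Qed.

End Degrees.

Lemma not_plane (k : closedFieldType) (D D' : trinomial_data k) :
  [pchar k] =i pred0 -> rank D = 1%N -> (2 <= rank D')%N ->
  (forall i, (i <= rank D')%N -> (2 <= expo D' i)%N) ->
  forall (f : {lrmorphism trinomial_algebra D -> trinomial_algebra D'}) g,
  cancel f g -> cancel g f -> False.
Proof.
move=> char0 r1 r2 b2 f g fK gK.
have [i|rho rhoP] := @grading_exists k D (fun i => (i == 0)%N : nat) 0%N.
  by rewrite r1; lia.
have [rho' rhoP'] := std_grading_exists D'.
have [C hC] := order_proportional char0 r2 b2 fK gK rhoP rhoP'.
(* The generator of weight 1 gives [1 = C * e]. *)
have C0 : C != 0.
  have g0 : gen D 0 != 0 by rewrite -(monU (@ord0 (rank D))) mon_neq0.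
  have [e he] := order_exists rhoP' (iso_neq0 fK g0).
  have := hC _ 1%N e (rhoP.1 0%N (leq0n _)) he.
  by apply: contra_eq_neq => ->; rewrite mul0r oner_neq0.
(* Only the empty monomial has standard weight 0, so this component is a scalar; subtracting it
   gives [b]. *)
have [xi xiE] : exists xi, (rho' (f (gen D 1)))`_0 = xi *: mon 0%MM.
  apply: (comp_mon_unique rhoP'); first exact: mwt0.
  move=> m m0; apply: mwt_inj; rewrite ?mwt0 m0 //; exact: degL_gt0.
pose b := gen D 1 - xi%:A.
(* Were [gen D 1] constant, its power would take the same value at all points, whereas
   [point_exists] prescribes that value freely. *)
have b0 : b != 0.
  apply/eqP => /eqP; rewrite subr_eq0 => /eqP gE.
  have pt v : xi ^+ expo D 1 = v.
    have [ev [_ e1 _ evZ]] := point_exists D 0 v.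
    by rewrite -e1 gE evZ rmorph1 mulr1.
  by have := oner_neq0 k; rewrite -(pt 1) (pt 0) eqxx.
have hb : rho b = b%:P * 'X^0.
  rewrite /b rmorphB rhoP.2 rmorph1 (rhoP.1 1%N) ?r1 // !expr0 !mulr1.
  by rewrite polyCB.
have [[|e] [low nz]] := order_exists rhoP' (iso_neq0 fK b0).
  move: nz; rewrite /b rmorphB /= linearZ /= rmorph1 rmorphB /= coefB xiE rhoP'.2.
  by rewrite rmorph1 mulr1 coefC mon0 subrr eqxx.
have := hC _ _ _ hb (conj low nz) => /esym/eqP.
by rewrite mulf_eq0 (negPf C0) (negPf (natr_neq0 char0 _)).
Qed.

(** * Matching of the generators of the two algebras *)

Section Matching.
Variables (k : closedFieldType) (D D' : trinomial_data k).
Local Notation B := (trinomial_algebra D).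
Local Notation B' := (trinomial_algebra D').
Local Notation r := (rank D).
Local Notation r' := (rank D').

Hypothesis char0 : [pchar k] =i pred0.
Hypothesis r'_ge2 : (2 <= r')%N.
Hypothesis expo_ge2 : forall i, (i <= r)%N -> (2 <= expo D i)%N.
Hypothesis expo'_ge2 : forall i, (i <= r')%N -> (2 <= expo D' i)%N.

Variables (f : {lrmorphism B -> B'}) (g : B' -> B).
Hypotheses (fK : cancel f g) (gK : cancel g f).

Variable rho : {rmorphism B -> {poly B}}.
Hypothesis rhoP : is_grading (stdw D) rho.
Variable rho' : {rmorphism B' -> {poly B'}}.
Hypothesis rhoP' : is_grading (stdw D') rho'.

Lemma gen_match : exists C : k, C != 0 /\ forall i, (i <= r)%N ->
  exists j (mu : k), [/\ (j <= r')%N, (stdw D i)%:R = C * (stdw D' j)%:R, mu != 0,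
    forall l, (l < stdw D' j)%N -> (rho' (f (gen D i)))`_l = 0
  & (rho' (f (gen D i)))`_(stdw D' j) = mu *: gen D' j].
Proof.
have [C hC] := order_proportional char0 r'_ge2 expo'_ge2 fK gK rhoP rhoP'.
have gen_neq0 i : (i <= r)%N -> gen D i != 0.
  by rewrite -ltnS => ir; rewrite -(monU (Ordinal ir)) mon_neq0.
have C0 : C != 0.
  have [e he] := order_exists rhoP' (iso_neq0 fK (gen_neq0 0%N (leq0n _))).
  have /eqP := hC _ _ e (rhoP.1 0%N (leq0n _)) he.
  apply: contraTneq => ->; rewrite mul0r natr_neq0 //; exact: stdw_gt0.
exists C; split=> // i ir.
(* Up to [C], each degree of the target is a degree of the source. The lowest component of
   [x = g y], of degree [n], has an image of order [e], and the other components have images of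
   larger order. So [y] has a nonzero component of degree [e], and [e] is the weight of the monomial
   [y]. *)
have pull (m' : 'X_{1..r'.+1}) : exists m : 'X_{1..r.+1},
    (mwt (stdw D) m)%:R = C * (mwt (stdw D') m')%:R.
  pose y : B' := mon m'; have y0 : y != 0 := mon_neq0 _.
  pose x := g y; have fx : f x = y by rewrite /x gK.
  have xE := comp_sum rhoP x.
  have ex : exists n, (rho x)`_n != 0.
    apply: contrapT => no; move: y0; rewrite -fx xE big1 ?rmorph0 ?eqxx // => l _.
    by apply/eqP/negPn/negP => h; apply: no; exists l.
  case: (ex_minnP ex) => n xn minn.
  have [e he] := order_exists rhoP' (iso_neq0 fK xn).
  have nE := hC _ _ _ (grading_comp rhoP x n) he.
  suff ee : e = mwt (stdw D') m'.
    have [m mE] := comp_exists_mon rhoP xn.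
    by exists m; rewrite mE -ee.
  have ns : (n < size (rho x))%N.
    by rewrite ltnNge; apply: contra xn => h; rewrite nth_default.
  have : (rho' y)`_e != 0.
    rewrite -fx xE raddf_sum raddf_sum coef_sum (bigD1 (Ordinal ns)) //=.
    rewrite big1 ?addr0; first by case: he.
    move=> l ln; case: (eqVneq (rho x)`_l 0) => [->|xl].
      by rewrite rmorph0 rmorph0 coef0.
    have [el hel] := order_exists rhoP' (iso_neq0 fK xl).
    have lE := hC _ _ _ (grading_comp rhoP x l) hel.
    apply: hel.1; apply: (proportional_lt char0 C0 nE lE).
    by rewrite ltn_neqAle minn // andbT eq_sym -val_eqE in ln *.
  rewrite (grading_mon rhoP') coefCM coefXn.
  by case: (eqVneq e (mwt (stdw D') m')) => [-> //|_]; rewrite mulr0 eqxx.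
have [e he] := order_exists rhoP' (iso_neq0 fK (gen_neq0 i ir)).
have iE := hC _ _ e (rhoP.1 i ir) he.
have [m' m'E] := comp_exists_mon rhoP' he.2.
have /choice[b bE] j : exists m : 'X_{1..r.+1},
    (mwt (stdw D) m)%:R = C * (stdw D' (nat_of_ord (j : 'I_r'.+1)))%:R.
  by have [m mE] := pull U_(j)%MM; exists m; rewrite mE mwtU.
have ir' := ir; rewrite -ltnS in ir'; pose io := Ordinal ir'.
(* [w_i] is indecomposable in the semigroup of degrees, which forces the monomial
   [m'] of the lowest component to be a single variable. *)
have ME : (\sum_j b j *+ m' j)%MM = U_(io)%MM.
  apply: esym; apply: mwt_inj; rewrite mwtU; last exact: stdw_ltL ir (expo_ge2 ir).
  apply: (natr_inj char0); rewrite /= iE mwt_sum natr_sum -m'E.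
  rewrite [mwt (stdw D') m']/mwt natr_sum mulr_sumr.
  by apply: eq_bigr => j _; rewrite mwtMn !natrM bE; ring.
have mdeg_b j : (0 < mdeg (b j))%N.
  rewrite lt0n mdeg_eq0; apply/eqP => b0; have /eqP := bE j.
  rewrite b0 mwt0 eq_sym mulf_eq0 (negPf C0) (negPf (natr_neq0 char0 _)) //.
  by apply: stdw_gt0; rewrite -ltnS.
(* Each [b j] has positive degree, so [mdeg m'] is at most the degree of the sum in [ME]; it is not
   0 because [gen D i] has positive weight. *)
have m'1 : mdeg m' = 1%N.
  apply/eqP; rewrite eqn_leq; apply/andP; split.
    have <- : mdeg (\sum_j b j *+ m' j)%MM = 1%N by rewrite ME mdeg1.
    rewrite mdeg_sum mdegE; apply: leq_sum => j _.
    by rewrite mdegMn leq_pmull.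
  rewrite lt0n mdeg_eq0; apply/eqP => m'0; move: iE; rewrite -m'E m'0 mwt0 mulr0.
  by apply/eqP; rewrite natr_neq0 // stdw_gt0.
have /mdeg1P[j /eqP jE] : mdeg m' == 1%N by rewrite m'1.
have eE : e = stdw D' j by rewrite -m'E jE mwtU.
have jr : (j <= r')%N by rewrite -ltnS.
have [low nz] := he; rewrite eE in low nz iE.
have [m2 m2E|mu muE] := comp_mon_unique rhoP' (f (gen D i)) (mwtU (stdw D') j).
  by apply: mwt_inj; rewrite ?mwtU ?m2E // stdw_ltL // expo'_ge2.
exists j, mu; split=> //; last by rewrite muE monU.
by apply: contraNneq nz => mu0; rewrite muE mu0 scale0r.
Qed.

End Matching.

(** * Data in Mori form *)

Lemma trinomial_data_eq (k : fieldType) (D D' : trinomial_data k) :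
  rank D = rank D' ->
  (forall i, (i <= rank D)%N -> expo D i = expo D' i) ->
  (forall i, (2 <= i <= rank D)%N -> coef D i = coef D' i) -> D = D'.
Proof.
case: D => r e c r1 e0 ec c0 cu; case: D' => r' e' c' r1' e0' ec' c0' cu' /= rE.
subst r'; rewrite /expo /coef /= => he hc.
have ? : e = e'.
  apply/val_inj/(@eq_from_nth _ 0%N); rewrite ?size_tuple //.
have ? : c = c'.
  apply/val_inj/(@eq_from_nth _ 0); rewrite ?size_tuple // => i ir.
  by have := hc i.+2; rewrite !subSS subn0; apply; lia.
subst e' c'; congr TrinomialData; exact: bool_irrelevance.
Qed.

Lemma mori_rank_ge2 (k : fieldType) (D : trinomial_data k) :
  mori_form D -> (2 <= rank D)%N ->
  [/\ coef D 2 = 1, forall i, (i < rank D)%N -> (expo D i.+1 < expo D i)%N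
    & forall i, (i <= rank D)%N -> (2 <= expo D i)%N].
Proof.
case=> [[-> //]|[_ c2 dec e2]] r2; split=> // i ir.
have [n] : exists n, rank D = (i + n)%N by exists (rank D - i)%N; lia.
elim: n i ir => [|n IH] i ir rE; first by rewrite rE addn0 in e2.
by apply: leq_trans (ltnW (dec i _)); [apply: IH|]; lia.
Qed.

(** * Recovery of the rank, the exponents and the coefficients *)

Section MoriIso.
Variables (k : closedFieldType) (D D' : trinomial_data k).
Hypothesis char0 : [pchar k] =i pred0.
Hypotheses (moriD : mori_form D) (moriD' : mori_form D').
Hypotheses (r_ge2 : (2 <= rank D)%N) (r'_ge2 : (2 <= rank D')%N).
Variables (f : {lrmorphism trinomial_algebra D -> trinomial_algebra D'}).
Variable g : trinomial_algebra D' -> trinomial_algebra D.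
Hypotheses (fK : cancel f g) (gK : cancel g f).
Variable rho' : {rmorphism trinomial_algebra D' -> {poly trinomial_algebra D'}}.
Hypothesis rhoP' : is_grading (stdw D') rho'.

(** The exponents decrease strictly, so the weights increase strictly on both sides; proportionality
    preserves their order, which makes the matching [s] increasing. *)
Lemma mori_match : exists (C : k) s (mu : nat -> k),
  [/\ C != 0, (forall i, (i < rank D)%N -> (s i < s i.+1)%N)
    & forall i, (i <= rank D)%N ->
    [/\ (s i <= rank D')%N, (stdw D i)%:R = C * (stdw D' (s i))%:R, mu i != 0,
        forall l, (l < stdw D' (s i))%N -> (rho' (f (gen D i)))`_l = 0
      & (rho' (f (gen D i)))`_(stdw D' (s i)) = mu i *: gen D' (s i)]].
Proof.
have [_ dec e2] := mori_rank_ge2 moriD r_ge2.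
have [_ dec' e2'] := mori_rank_ge2 moriD' r'_ge2.
have [rho rhoP] := std_grading_exists D.
have [C [C0 hC]] := gen_match char0 r'_ge2 e2 e2' fK gK rhoP rhoP'.
have /choice[sm hsm] i : exists sm : nat * k, (i <= rank D)%N ->
    [/\ (sm.1 <= rank D')%N, (stdw D i)%:R = C * (stdw D' sm.1)%:R, sm.2 != 0,
        forall l, (l < stdw D' sm.1)%N -> (rho' (f (gen D i)))`_l = 0
      & (rho' (f (gen D i)))`_(stdw D' sm.1) = sm.2 *: gen D' sm.1].
  case: (leqP i (rank D)) => ir; last by exists (0%N, 0).
  by have [j [mu h]] := hC i ir; exists (j, mu).
exists C, (fun i => (sm i).1), (fun i => (sm i).2); split=> // i ir.
have [ls wE _ _ _] := hsm i (ltnW ir); have [ls' wE' _ _ _] := hsm i.+1 ir.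
have w_lt : (stdw D i < stdw D i.+1)%N.
  by apply: stdw_lt; rewrite // ?(ltnW ir) // dec.
have := proportional_lt char0 C0 wE wE' w_lt; rewrite !ltnNge; apply: contra => le.
have [-> //|ne] := eqVneq (sm i.+1).1 (sm i).1.
apply: ltnW; apply: stdw_lt => //.
have : ((sm i.+1).1 < (sm i).1)%N by rewrite ltn_neqAle ne.
elim: (sm i).1 ls => // n IH nr; rewrite ltnS leq_eqVlt => /orP[/eqP->|lt].
  exact: dec'.
by apply: ltn_trans (IH (ltnW nr) lt); apply: dec'.
Qed.

(** Applied to the isomorphism and to its inverse, this gives equality of ranks. *)
Lemma mori_rank_le : (rank D <= rank D')%N.
Proof.
have [C [s [mu [_ inc hs]]]] := mori_match.
by have [ls _ _ _ _] := hs _ (leqnn _); apply: leq_trans (increasing_ge inc _) ls.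
Qed.

Hypothesis rank_eq : rank D = rank D'.

Lemma mori_iso_eq : D = D'.
Proof.
have [c2 _ _] := mori_rank_ge2 moriD r_ge2.
have [c2' _ _] := mori_rank_ge2 moriD' r'_ge2.
have [C [s [mu [C0 inc hs]]]] := mori_match.
have sr : (s (rank D) <= rank D)%N by have [] := hs _ (leqnn _); rewrite -rank_eq.
have sid := increasing_id sr inc.
have {}hs i : (i <= rank D)%N ->
    [/\ (stdw D i)%:R = C * (stdw D' i)%:R, mu i != 0,
        forall l, (l < stdw D' i)%N -> (rho' (f (gen D i)))`_l = 0
      & (rho' (f (gen D i)))`_(stdw D' i) = mu i *: gen D' i].
  by move=> ir; have [_] := hs i ir; rewrite sid.
have r1 := rank_ge1 D.
have expo_cross i j : (i <= rank D)%N -> (j <= rank D)%N ->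
    (expo D i * expo D' j = expo D j * expo D' i)%N.
  move=> ir jr; have [wi _ _ _] := hs i ir; have [wj _ _ _] := hs j jr.
  have cross : (stdw D i * stdw D' j = stdw D j * stdw D' i)%N.
    by apply: (natr_inj char0); rewrite !natrM wi wj; ring.
  have := stdw_expo ir; have := stdw_expo jr.
  have ir' := ir; have jr' := jr; rewrite rank_eq in ir' jr'.
  have := stdw_expo ir'; have := stdw_expo jr'.
  have wi0 := stdw_gt0 ir; have wj0' := stdw_gt0 jr'.
  move=> ej' ei' ej ei; apply/eqP.
  rewrite -(eqn_pmul2l (_ : 0 < stdw D i * stdw D' j)%N) ?muln_gt0 ?wi0 ?wj0' //.
  apply/eqP; transitivity (degL D * degL D')%N; first by rewrite -ei -ej'; ring.
  by rewrite cross -ej -ei'; ring.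
(* In the cross relation for 0 and 1, coprimality within each datum makes [expo D 0] and [expo D' 0]
   divide each other. *)
have e0E : expo D 0 = expo D' 0.
  have cr := expo_cross 0%N 1%N (leq0n _) r1.
  have co := expo_coprime (leq0n (rank D) : (0 <= rank D)%N) r1 isT.
  have r1' := rank_ge1 D'.
  have co' := expo_coprime (leq0n (rank D') : (0 <= rank D')%N) r1' isT.
  apply/eqP; rewrite eqn_dvd; apply/andP; split.
    by rewrite -(Gauss_dvdr _ co) -cr dvdn_mulr.
  by rewrite -(Gauss_dvdl _ co') cr dvdn_mull.
have eE i : (i <= rank D)%N -> expo D i = expo D' i.
  move=> ir; have := expo_cross i 0%N ir (leq0n _); rewrite -e0E mulnC => /eqP.
  by rewrite eqn_pmul2l ?expo_gt0 // => /eqP.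
have low i : (i <= rank D)%N ->
    (rho' (f (gen D i ^+ expo D i)))`_(degL D') = mu i ^+ expo D i *: gen D' i ^+ expo D' i.
  move=> ir; have [_ _ lo top] := hs i ir.
  rewrite -(@stdw_expo _ D' i) -?rank_eq // -(eE i ir) !rmorphXn.
  by rewrite (lowest_coef_exp _ lo top) exprZn.
(* In the component of degree [degL D'] of the image of a relation, the power of [gen D' i] is
   eliminated by the relation of [D']; [gen01_indep] then compares coefficients. *)
have rel i : (2 <= i <= rank D)%N ->
    mu 0%N ^+ expo D 0 = mu i ^+ expo D i /\
    coef D i * mu 1%N ^+ expo D 1 = mu i ^+ expo D i * coef D' i.
  move=> i2r; have := congr1 (fun x => (rho' (f x))`_(degL D')) (gen_trinomial i2r).
  have := @gen_trinomial _ D' i; rewrite -rank_eq => /(_ i2r).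
  move/(canRL (addKr _)); rewrite addr0 => ti; case/andP: i2r => i2 ir.
  rewrite !rmorph0 coef0 !rmorphD /= linearZ /= rhoP'.2 !coefD coefCM mulr_algl.
  rewrite !low // ti.
  set x := gen D' 0 ^+ _; set y := gen D' 1 ^+ _.
  rewrite scalerN scalerDr opprD !scalerA -!scaleNr addrACA -!scalerDl.
  by move/gen01_indep => [/eqP + /eqP]; rewrite !addr_eq0 !opprK => /eqP-> /eqP->.
(* The normalization of the second coefficient to 1 in both data removes the remaining scaling
   freedom. *)
have mu01 : mu 1%N ^+ expo D 1 = mu 0%N ^+ expo D 0.
  have [|-> ] := rel 2%N; first by rewrite r_ge2.
  by rewrite c2 c2' mul1r mulr1.
apply: trinomial_data_eq => // i i2r; have [e1 e2] := rel i i2r.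
have [_ mu0 _ _] := hs 0%N (leq0n _).
apply: (mulIf (_ : mu 0%N ^+ expo D 0 != 0)); first by rewrite expf_neq0.
by rewrite -{1}mu01 e2 -e1 mulrC.
Qed.

End MoriIso.

(** [not_plane] and [mori_rank_le] are asymmetric and are also applied to the inverse, which must
    therefore be a morphism of algebras. *)
Lemma lrmorphism_inverse (k : fieldType) (A A' : comAlgType k)
    (f : {lrmorphism A -> A'}) g : cancel f g -> cancel g f ->
  exists h : {lrmorphism A' -> A}, h =1 g.
Proof.
move=> fK gK; have g_add : additive g.
  by move=> x y; apply: (can_inj fK); rewrite gK rmorphB /= !gK.
have g_mul : monoid_morphism g.
  split=> [|x y]; apply: (can_inj fK); first by rewrite gK rmorph1.
  by rewrite gK rmorphM /= !gK.
have g_scale : scalable g.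
  by move=> c x; apply: (can_inj fK); rewrite gK linearZ /= gK.
pose ga := GRing.isAdditive.Build A' A g g_add.
pose gm := GRing.isMonoidMorphism.Build A' A g g_mul.
pose gs := GRing.isScalable.Build k A' A *:%R g g_scale.
by exists (HB.pack_for {lrmorphism A' -> A} g ga gm gs).
Qed.

Theorem theorem6p5 (k : closedFieldType) (D D' : trinomial_data k) :
  [pchar k]%R =i pred0 ->
  mori_form D -> mori_form D' ->
  (exists f : {lrmorphism trinomial_algebra D -> trinomial_algebra D'},
     bijective f) ->
  D = D'.
Proof.
move=> char0 mD mD' [f [g fK gK]].
have [h hE] := lrmorphism_inverse fK gK.
have hK : cancel h f by move=> x; rewrite hE gK.
have fKh : cancel f h by move=> x; rewrite hE fK.
have [rho rhoP] := std_grading_exists D.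
have [rho' rhoP'] := std_grading_exists D'.
(* Two data of rank 1 coincide, mixed ranks contradict [not_plane], and the remaining case is that
   of two ranks at least 2. *)
case: (leqP (rank D) 1) => r1; case: (leqP (rank D') 1) => r1'.
- case: mD => [[rE e0 e1]|[]]; last by lia.
  case: mD' => [[rE' e0' e1']|[]]; last by lia.
  apply: trinomial_data_eq; rewrite rE ?rE' //; last by move=> i; lia.
  by case=> [|[|i]] //; rewrite ?e0 ?e1.
- have [_ _ e2'] := mori_rank_ge2 mD' r1'.
  have rE : rank D = 1%N by have := rank_ge1 D; lia.
  by case: (not_plane char0 rE r1' e2' fK gK).
- have [_ _ e2] := mori_rank_ge2 mD r1.
  have rE' : rank D' = 1%N by have := rank_ge1 D'; lia.
  by case: (not_plane char0 rE' r1 e2 hK fKh).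
have le := mori_rank_le char0 mD mD' r1 r1' fK gK rhoP'.
have ge := mori_rank_le char0 mD' mD r1' r1 hK fKh rhoP.
by apply: (mori_iso_eq char0 mD mD' r1 r1' fK gK rhoP'); lia.
Qed.
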